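(* There is a computably discrete, computably Hausdorff, precomputably Quasi-Polish space $\mathbf{X}$ such that there is no computable injection $\iota:\mathbf{X}\to\mathbb{N}$.
   Context: A represented space $\mathbf{X}=(X,\delta_{\mathbf{X}})$ is a set $X$ with a partial surjection $\delta_{\mathbf{X}}:\subseteq\mathbb{N}^{\mathbb{N}}\to X$; any $p$ with $\delta_{\mathbf X}(p)=x$ is a name of $x$. A realiser of a map $f:\mathbf{X}\to\mathbf{Y}$ is a partial map $R_f:\subseteq\mathbb{N}^{\mathbb{N}}\to\mathbb{N}^{\mathbb{N}}$ sending every name of every $x\in X$ to a name of $f(x)$; $f$ is computable if it has a computable realiser. A computable isomorphism is a computable bijection with computable inverse. $\mathbb{N}$ is represented by $\delta_{\mathbb N}(p)=p(0)$. In the product $\mathbf{X}\times\mathbf{Y}$, $p$ names $(x,y)$ iff $n\mapsto p(2n)$ names $x$ and $n\mapsto p(2n+1)$ names $y$. Sierpinski space $\mathbb{S}=\{\top,\bot\}$ is represented so that $0^\omega$ names $\bot$ and every other sequence names $\top$. A subset of $\mathbf{X}$ is computably open if its characteristic function $\mathbf{X}\to\mathbb{S}$ (value $\top$ exactly on the set) is computable, and computably closed if its complement is computably open. $\mathbf{X}$ is computably discrete (computably Hausdorff) if the diagonal $\{(x,x)\}\subseteq\mathbf{X}\times\mathbf{X}$ is computably open (computably closed). For a transitive relation $\ll$ on $\mathbb{N}$, an ideal is a non-empty $I\subseteq\mathbb{N}$ such that $x\ll y\in I$ implies $x\in I$, and for all $x,y\in I$ there is $z\in I$ with $x\ll z$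 and $y\ll z$. $\mathbf{I}(\ll)$ is the represented space of ideals, where $p$ names $I$ iff $I=\{p(k)\mid k\in\mathbb{N}\}$. A represented space is precomputably Quasi-Polish if it is computably isomorphic to $\mathbf{I}(\ll)$ for some computably enumerable transitive relation $\ll$ on $\mathbb N$. *)

(* Defs.v *)
From Stdlib Require Import Arith FinFun Cantor Relations.
From Stdlib Require Import ClassicalEpsilon FunctionalExtensionality PropExtensionality.

Set Implicit Arguments.
Unset Strict Implicit.
#[local] Obligation Tactic := idtac.

(** Oracle computability: Kleene's partial recursive functions relative to an
    oracle in Baire space, in their unary form (arguments are tupled with the
    Cantor pairing of the standard library). *)

Definition baire : Type := nat -> nat.

Definition pair (x y : nat) : nat := Cantor.to_nat (x, y).

Inductive code : Type :=
| cZero | cSucc | cFst | cSnd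
| cOracle
| cPair (f g : code)
| cComp (f g : code)
| cPrec (f g : code)
| cMu (f : code).

(** [eval o c x y]: with oracle [o], the program [c] halts on input [x] with
    output [y].  [cPrec f g] is primitive recursion on the second component of
    the input, with parameter the first.  On input [pair x n], [cMu f] returns
    the least [m >= n] with [f (pair x m) = 0], provided that [f] halts on
    [pair x k] for all [k] with [n <= k <= m]; ordinary minimisation is the
    case [n = 0]. *)
Inductive eval (o : baire) : code -> nat -> nat -> Prop :=
| ev_zero x : eval o cZero x 0
| ev_succ x : eval o cSucc x (S x)
| ev_fst x y : eval o cFst (pair x y) x
| ev_snd x y : eval o cSnd (pair x y) y
| ev_oracle x : eval o cOracle x (o x)
| ev_pair f g x y z :
    eval o f x y -> eval o g x z -> eval o (cPair f g) x (pair y z)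
| ev_comp f g x y z :
    eval o g x y -> eval o f y z -> eval o (cComp f g) x z
| ev_prec_0 f g x y :
    eval o f x y -> eval o (cPrec f g) (pair x 0) y
| ev_prec_S f g x n y z :
    eval o (cPrec f g) (pair x n) y ->
    eval o g (pair x (pair n y)) z ->
    eval o (cPrec f g) (pair x (S n)) z
| ev_mu_stop f x n :
    eval o f (pair x n) 0 -> eval o (cMu f) (pair x n) n
| ev_mu_next f x n v m :
    eval o f (pair x n) (S v) ->
    eval o (cMu f) (pair x (S n)) m ->
    eval o (cMu f) (pair x n) m.

(** Computability without oracle is computability relative to the constant
    zero sequence; a relation is c.e. when it is the domain of a partial
    computable function. *)
Definition ce_relation (R : relation nat) : Prop :=
  exists c : code, forall x y : nat,
    R x y <-> exists v : nat, eval (fun _ => 0) c (pair x y) v.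

(** Partial maps, given by their graphs. *)
Record pmap (A B : Type) : Type := PMap {
  graph :> A -> B -> Prop;
  graph_functional : forall a b b', graph a b -> graph a b' -> b = b'
}.

(** As usual in computable analysis, the program is only constrained on the
    domain of the partial map. *)
Definition computable_pmap (F : pmap baire baire) : Prop :=
  exists c : code, forall p q : baire, F p q -> forall n, eval p c n (q n).

Record represented_space : Type := RepresentedSpace {
  point :> Type;
  delta : pmap baire point;
  delta_surjective : forall x : point, exists p, delta p x
}.

Arguments delta : clear implicits.

Definition is_realiser (X Y : represented_space) (f : X -> Y)
    (F : pmap baire baire) : Prop :=
  forall (x : X) (p : baire), delta X p x ->
    exists q : baire, F p q /\ delta Y q (f x).

Definition computable (X Y : represented_space) (f : X -> Y) : Prop :=
  exists F : pmap baire baire, is_realiser f F /\ computable_pmap F.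

Definition computably_isomorphic (X Y : represented_space) : Prop :=
  exists (f : X -> Y) (g : Y -> X),
    (forall x, g (f x) = x) /\ (forall y, f (g y) = y) /\
    computable f /\ computable g.

Program Definition nat_space : represented_space :=
  @RepresentedSpace nat (@PMap baire nat (fun p n => p 0 = n) _) _.
Next Obligation. now intros p n n' <- <-. Qed.
Next Obligation. now intros n; exists (fun _ => n). Qed.

Program Definition prod_space (X Y : represented_space) : represented_space :=
  @RepresentedSpace (X * Y)
    (@PMap baire (X * Y)
       (fun p xy => delta X (fun n => p (2 * n)) (fst xy) /\
                    delta Y (fun n => p (2 * n + 1)) (snd xy)) _) _.
Next Obligation.
  intros X Y p [x y] [x' y'] [Hx Hy] [Hx' Hy']; simpl in *.
  now rewrite (graph_functional Hx Hx'), (graph_functional Hy Hy').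
Qed.
Next Obligation.
  intros X Y [x y].
  destruct (delta_surjective x) as [p Hp], (delta_surjective y) as [q Hq].
  exists (fun n => if Nat.even n then p (Nat.div2 n) else q (Nat.div2 n)).
  cbn [graph fst snd]; split.
  - replace (fun n => _) with p; [exact Hp|].
    extensionality n.
    now rewrite Nat.even_mul, Nat.div2_double.
  - replace (fun n => _) with q; [exact Hq|].
    extensionality n.
    now rewrite Nat.even_add, Nat.even_mul, Nat.add_1_r, Nat.div2_succ_double.
Qed.

Inductive sierpinski : Type := Top | Bot.

Program Definition sierpinski_space : represented_space :=
  @RepresentedSpace sierpinski
    (@PMap baire sierpinski
       (fun p s => match s with
                   | Bot => forall n, p n = 0
                   | Top => ~ forall n, p n = 0
                   end) _) _.
Next Obligation.
  now intros p [] []; intros H H'; try reflexivity; exfalso; auto.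
Qed.
Next Obligation.
  intros [].
  - exists (fun _ => 1); intros H; discriminate (H 0).
  - now exists (fun _ => 0).
Qed.

(** [chi] below is the characteristic function of [U]; it is uniquely
    determined by [U]. *)
Definition computably_open (X : represented_space) (U : X -> Prop) : Prop :=
  exists chi : X -> sierpinski_space,
    (forall x, chi x = Top <-> U x) /\ computable chi.

Definition computably_closed (X : represented_space) (A : X -> Prop) : Prop :=
  computably_open (fun x => ~ A x).

Definition diagonal (X : represented_space) : prod_space X X -> Prop :=
  fun xy => fst xy = snd xy.

Arguments diagonal : clear implicits.

Definition computably_discrete (X : represented_space) : Prop :=
  computably_open (diagonal X).

Definition computably_hausdorff (X : represented_space) : Prop :=
  computably_closed (diagonal X).

Definition is_ideal (R : relation nat) (I : nat -> Prop) : Prop :=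
  (exists x, I x) /\
  (forall x y, R x y -> I y -> I x) /\
  (forall x y, I x -> I y -> exists z, I z /\ R x z /\ R y z).

Program Definition ideal_space (R : relation nat) : represented_space :=
  @RepresentedSpace {I : nat -> Prop | is_ideal R I}
    (@PMap baire {I : nat -> Prop | is_ideal R I}
       (fun p I => forall n, proj1_sig I n <-> exists k, p k = n) _) _.
Next Obligation.
  intros R p [I HI] [J HJ] H H'; simpl in *.
  assert (E : I = J).
  { extensionality n; apply propositional_extensionality.
    now rewrite H, H'. }
  subst J; f_equal; apply proof_irrelevance.
Qed.
Next Obligation.
  intros R [I HI]; cbn [graph proj1_sig].
  destruct (proj1 HI) as [a Ha].
  exists (fun n => if excluded_middle_informative (I n) then n else a).
  intros n; split.
  - intros Hn; exists n; now destruct (excluded_middle_informative (I n)).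
  - intros [k <-]; now destruct (excluded_middle_informative (I k)).
Qed.

Definition precomputably_quasi_Polish (X : represented_space) : Prop :=
  exists R : relation nat,
    transitive nat R /\ ce_relation R /\
    computably_isomorphic X (ideal_space R).

(* Main.v *)
Require Import Defs.
From Stdlib Require Import FinFun.
From Stdlib Require Import Arith Lia Bool Cantor Relations.
From Stdlib Require Import ClassicalEpsilon FunctionalExtensionality PropExtensionality.

(** For every program [e] we set up two chains of naturals, each of which is
    an ideal if its order relation is never cut off at a finite level, and run
    [e] on an enumeration of each.  The first chain ([true] below) is a point
    only once [e] has halted on the second; the second is abandoned when [e]
    halts on it, and resumed if [e] also halts on the first.  If [e] fails to halt on one of them, then a chain on which it
    fails to halt is the only point of the component.  If it halts on both, the
    two chains are merged into a single point when the two outputs differ, and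
    kept as two distinct points when they agree; so [e] is either not well
    defined or not injective.  Given names of two points that start in
    different chains of the component of [e], the program must halt on both,
    and comparing the outputs decides equality. *)

(** * Projections of the Cantor pairing *)

Definition pfst (n : nat) : nat := fst (Cantor.of_nat n).
Definition psnd (n : nat) : nat := snd (Cantor.of_nat n).

Lemma pfst_pair x y : pfst (pair x y) = x.
Proof. unfold pfst, pair; now rewrite Cantor.cancel_of_to. Qed.

Lemma psnd_pair x y : psnd (pair x y) = y.
Proof. unfold psnd, pair; now rewrite Cantor.cancel_of_to. Qed.

Lemma pair_eta n : pair (pfst n) (psnd n) = n.
Proof.
  unfold pfst, psnd, pair; rewrite <- surjective_pairing.
  apply Cantor.cancel_to_of.
Qed.

Lemma le_pair_r x y : y <= pair x y.
Proof. unfold pair; pose proof (Cantor.to_nat_non_decreasing x y); lia. Qed.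

Global Opaque pair pfst psnd.

Ltac unpair := repeat (rewrite pfst_pair || rewrite psnd_pair).

(** * Total computable functionals *)

Definition computable_fun (F : baire -> nat -> nat) : Prop :=
  exists c, forall o x, eval o c x (F o x).

Definition computable_test (B : baire -> nat -> bool) : Prop :=
  computable_fun (fun o x => if B o x then 1 else 0).

Lemma computable_fun_ext F G :
  (forall o x, F o x = G o x) -> computable_fun F -> computable_fun G.
Proof. intros E [c Hc]; exists c; intros o x; rewrite <- E; apply Hc. Qed.

Lemma computable_id : computable_fun (fun _ x => x).
Proof.
  exists (cPair cFst cSnd); intros o x.
  rewrite <- (pair_eta x); repeat constructor.
Qed.

Lemma computable_comp F G :
  computable_fun F -> computable_fun G -> computable_fun (fun o x => F o (G o x)).
Proof.
  intros [f Hf] [g Hg]; exists (cComp f g); intros o x.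
  now apply ev_comp with (G o x).
Qed.

Lemma computable_pair F G :
  computable_fun F -> computable_fun G ->
  computable_fun (fun o x => pair (F o x) (G o x)).
Proof. intros [f Hf] [g Hg]; exists (cPair f g); intros o x; now constructor. Qed.

Lemma computable_pfst F :
  computable_fun F -> computable_fun (fun o x => pfst (F o x)).
Proof.
  apply (computable_comp (fun _ x => pfst x)); exists cFst; intros o x.
  rewrite <- (pair_eta x) at 1; constructor.
Qed.

Lemma computable_psnd F :
  computable_fun F -> computable_fun (fun o x => psnd (F o x)).
Proof.
  apply (computable_comp (fun _ x => psnd x)); exists cSnd; intros o x.
  rewrite <- (pair_eta x) at 1; constructor.
Qed.

Lemma computable_succ F :
  computable_fun F -> computable_fun (fun o x => S (F o x)).
Proof.
  apply (computable_comp (fun _ x => S x)); exists cSucc; intros o x; constructor.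
Qed.

Lemma computable_oracle F :
  computable_fun F -> computable_fun (fun o x => o (F o x)).
Proof.
  apply (computable_comp (fun o x => o x)); exists cOracle; intros o x; constructor.
Qed.

Lemma computable_const n : computable_fun (fun _ _ => n).
Proof.
  induction n; [exists cZero; intros o x; constructor|].
  now apply (computable_succ (fun _ _ => n)).
Qed.

(** [cPrec] carries a single parameter; taking the whole input [x] as that parameter lets the count,
    the base and the step all depend on it. *)
Lemma computable_rec N A (G : baire -> nat -> nat -> nat -> nat) :
  computable_fun N -> computable_fun A ->
  computable_fun (fun o w => G o (pfst w) (pfst (psnd w)) (psnd (psnd w))) ->
  computable_fun (fun o x => nat_rect (fun _ => nat) (A o x) (G o x) (N o x)).
Proof.
  intros HN [a Ha] [g Hg].
  set (F := fun o w => nat_rect (fun _ => nat) (A o (pfst w)) (G o (pfst w)) (psnd w)).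
  apply (computable_fun_ext (fun o x => F o (pair x (N o x)))).
  { intros o x; unfold F; now unpair. }
  apply (computable_comp F (fun o x => pair x (N o x)));
    [|apply (computable_pair (fun _ x => x)); trivial; apply computable_id].
  exists (cPrec a g); intros o w.
  rewrite <- (pair_eta w) at 1; unfold F; induction (psnd w); simpl.
  - constructor; apply Ha.
  - eapply ev_prec_S; [apply IHn|].
    generalize (Hg o (pair (pfst w) (pair n
      (nat_rect (fun _ => nat) (A o (pfst w)) (G o (pfst w)) n)))).
    now unpair.
Qed.

Lemma computable_iter N A (G : baire -> nat -> nat -> nat) :
  computable_fun N -> computable_fun A ->
  computable_fun (fun o w => G o (pfst w) (psnd w)) ->
  computable_fun (fun o x => Nat.iter (N o x) (G o x) (A o x)).
Proof.
  intros HN HA HG.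
  apply (computable_rec N A (fun o x _ y => G o x y)); trivial.
  apply (computable_fun_ext (fun o w =>
    (fun o w => G o (pfst w) (psnd w)) o (pair (pfst w) (psnd (psnd w))))).
  { intros o w; now unpair. }
  apply (computable_comp _ (fun _ w => pair (pfst w) (psnd (psnd w))) HG).
  apply computable_pair; repeat apply computable_pfst || apply computable_psnd;
    apply computable_id.
Qed.

Lemma computable_pred F :
  computable_fun F -> computable_fun (fun o x => pred (F o x)).
Proof.
  intros HF.
  apply (computable_fun_ext
    (fun o x => nat_rect (fun _ => nat) 0 (fun k _ => k) (F o x))).
  { intros o x; now destruct (F o x). }
  apply (computable_rec F (fun _ _ => 0) (fun _ _ k _ => k)); trivial.
  - apply computable_const.
  - apply computable_pfst, computable_psnd, computable_id.
Qed.

Lemma computable_add F G :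
  computable_fun F -> computable_fun G -> computable_fun (fun o x => F o x + G o x).
Proof.
  intros HF HG.
  apply (computable_fun_ext (fun o x => Nat.iter (F o x) S (G o x))).
  { intros o x; induction (F o x); simpl; congruence. }
  apply (computable_iter F G (fun _ _ y => S y)); trivial.
  apply computable_succ, computable_psnd, computable_id.
Qed.

Lemma computable_sub F G :
  computable_fun F -> computable_fun G -> computable_fun (fun o x => F o x - G o x).
Proof.
  intros HF HG.
  apply (computable_fun_ext (fun o x => Nat.iter (G o x) pred (F o x))).
  { intros o x; induction (G o x); simpl; lia. }
  apply (computable_iter G F (fun _ _ y => pred y)); trivial.
  apply computable_pred, computable_psnd, computable_id.
Qed.

Lemma computable_if B F G :
  computable_test B -> computable_fun F -> computable_fun G ->
  computable_fun (fun o x => if B o x then F o x else G o x).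
Proof.
  intros HB HF HG.
  apply (computable_fun_ext (fun o x =>
    nat_rect (fun _ => nat) (G o x) (fun _ _ => F o x) (if B o x then 1 else 0))).
  { intros o x; now destruct (B o x). }
  apply (computable_rec _ G (fun o x _ _ => F o x) HB HG).
  apply (computable_comp F (fun _ w => pfst w) HF).
  apply computable_pfst, computable_id.
Qed.

Lemma computable_eq0 F :
  computable_fun F -> computable_test (fun o x => F o x =? 0).
Proof.
  intros HF.
  apply (computable_fun_ext (fun o x => 1 - F o x)).
  { intros o x; destruct (F o x) as [|[|]]; reflexivity. }
  apply computable_sub; trivial; apply computable_const.
Qed.

Lemma computable_eqb F G :
  computable_fun F -> computable_fun G -> computable_test (fun o x => F o x =? G o x).
Proof.
  intros HF HG.
  apply (computable_fun_ext (fun o x =>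
    if (F o x - G o x) + (G o x - F o x) =? 0 then 1 else 0)).
  { intros o x.
    destruct (Nat.eqb_spec (F o x - G o x + (G o x - F o x)) 0),
      (Nat.eqb_spec (F o x) (G o x)); trivial; lia. }
  apply computable_eq0, computable_add; now apply computable_sub.
Qed.

Lemma computable_ltb F G :
  computable_fun F -> computable_fun G -> computable_test (fun o x => F o x <? G o x).
Proof.
  intros HF HG.
  apply (computable_fun_ext (fun o x => if S (F o x) - G o x =? 0 then 1 else 0)).
  { intros o x.
    destruct (Nat.eqb_spec (S (F o x) - G o x) 0), (Nat.ltb_spec (F o x) (G o x));
      trivial; lia. }
  apply computable_eq0, computable_sub; trivial; now apply computable_succ.
Qed.

Lemma computable_ifb B P Q :
  computable_test B -> computable_test P -> computable_test Q ->
  computable_test (fun o x => if B o x then P o x else Q o x).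
Proof.
  intros HB HP HQ.
  apply (computable_fun_ext (fun o x =>
    if B o x then (if P o x then 1 else 0) else (if Q o x then 1 else 0))).
  { intros o x; now destruct (B o x). }
  now apply computable_if.
Qed.

Lemma computable_negb P :
  computable_test P -> computable_test (fun o x => negb (P o x)).
Proof.
  intros HP.
  apply (computable_fun_ext (fun o x => if P o x then 0 else 1)).
  { intros o x; now destruct (P o x). }
  apply computable_if; trivial; apply computable_const.
Qed.

Lemma computable_andb P Q :
  computable_test P -> computable_test Q -> computable_test (fun o x => P o x && Q o x).
Proof.
  intros HP HQ; apply (computable_ifb P Q (fun _ _ => false)); trivial.
  exact (computable_const 0).
Qed.

Lemma computable_orb P Q :
  computable_test P -> computable_test Q -> computable_test (fun o x => P o x || Q o x).
Proof.
  intros HP HQ; apply (computable_ifb P (fun _ _ => true) Q); trivial.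
  exact (computable_const 1).
Qed.

Lemma computable_beq P Q :
  computable_test P -> computable_test Q -> computable_test (fun o x => eqb (P o x) (Q o x)).
Proof.
  intros HP HQ.
  apply (computable_fun_ext (fun o x =>
    if (if P o x then Q o x else negb (Q o x)) then 1 else 0)).
  { intros o x; now destruct (P o x), (Q o x). }
  apply (computable_ifb P Q (fun o x => negb (Q o x))); trivial.
  now apply computable_negb.
Qed.

(** A placeholder, redefined once [halted] and [result] are known to be computable, so that
    [computability] can treat them as primitives. *)
Ltac computability_hook := fail.

Ltac computability :=
  repeat first
    [ assumption
    | computability_hook
    | lazymatch goal with
      | |- computable_test _ =>
        first
          [ apply computable_eqb | apply computable_ltb | apply computable_negb
          | apply computable_andb | apply computable_orb | apply computable_beq
          | apply computable_ifb ]
      | |- computable_fun _ =>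
        first
          [ apply computable_id | apply computable_const | apply computable_pair
          | apply computable_pfst | apply computable_psnd | apply computable_succ
          | apply computable_pred | apply computable_add | apply computable_oracle
          | apply computable_if ]
      end ].

(** * A universal machine *)

Fixpoint encode (c : code) : nat :=
  match c with
  | cZero => pair 0 0
  | cSucc => pair 1 0
  | cFst => pair 2 0
  | cSnd => pair 3 0
  | cOracle => pair 4 0
  | cPair f g => pair 5 (pair (encode f) (encode g))
  | cComp f g => pair 6 (pair (encode f) (encode g))
  | cPrec f g => pair 7 (pair (encode f) (encode g))
  | cMu f => pair 8 (encode f)
  end.

(* A state is a stack of instructions together with the current value.  Tags
   up to 8 are programs to be run on the value; 9 and 10 are the pending
   halves of [cPair], 11 the pending step of [cPrec], 12 the pending test of
   [cMu]; any larger tag halts the machine. *)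
Definition step (o : baire) (st : nat) : nat :=
  let i := pfst (pfst st) in
  let k := psnd (pfst st) in
  let x := psnd st in
  let t := pfst i in
  let a := psnd i in
  if t =? 0 then pair k 0
  else if t =? 1 then pair k (S x)
  else if t =? 2 then pair k (pfst x)
  else if t =? 3 then pair k (psnd x)
  else if t =? 4 then pair k (o x)
  else if t =? 5 then pair (pair (pfst a) (pair (pair 9 (pair (psnd a) x)) k)) x
  else if t =? 6 then pair (pair (psnd a) (pair (pfst a) k)) x
  else if t =? 7 then
    (if psnd x =? 0 then pair (pair (pfst a) k) (pfst x)
     else let x' := pair (pfst x) (pred (psnd x)) in
       pair (pair i (pair (pair 11 (pair (psnd a) x')) k)) x')
  else if t =? 8 then pair (pair a (pair (pair 12 (pair a x)) k)) x
  else if t =? 9 then pair (pair (pfst a) (pair (pair 10 x) k)) (psnd a)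
  else if t =? 10 then pair k (pair a x)
  else if t =? 11 then
    pair (pair (pfst a) k) (pair (pfst (psnd a)) (pair (psnd (psnd a)) x))
  else if t =? 12 then
    (if x =? 0 then pair k (psnd (psnd a))
     else pair (pair (pair 8 (pfst a)) k)
            (pair (pfst (psnd a)) (S (psnd (psnd a)))))
  else st.

(** The simulated oracle [Q o x] may vary with the input. One step queries it at most at the current
    value of the machine, so only that answer has to be computable. *)
Lemma computable_step (Q : baire -> nat -> nat -> nat) (T : baire -> nat -> nat) :
  computable_fun T -> computable_fun (fun o x => Q o x (psnd (T o x))) ->
  computable_fun (fun o x => step (Q o x) (T o x)).
Proof. intros HT HQ; unfold step; cbv zeta; computability. Qed.

Lemma step_local o st : exists n, forall o',
  (forall k, k < n -> o' k = o k) -> step o' st = step o st.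
Proof.
  exists (S (psnd st)); intros o' H; unfold step; cbv zeta.
  now rewrite (H (psnd st)) by lia.
Qed.

(** The use principle: finitely many steps consult only a finite part of the oracle, so a run is
    unchanged when the rest of the oracle is replaced. *)
Lemma iter_step_local o t st : exists n, forall o',
  (forall k, k < n -> o' k = o k) -> Nat.iter t (step o') st = Nat.iter t (step o) st.
Proof.
  induction t as [|t [n IH]]; [now exists 0|].
  destruct (step_local o (Nat.iter t (step o) st)) as [m Hm].
  exists (n + m); intros o' H; simpl.
  rewrite IH by (intros; apply H; lia).
  apply Hm; intros; apply H; lia.
Qed.

(** * Correctness of the machine *)

Definition reaches (o : baire) (st st' : nat) : Prop :=
  exists t, Nat.iter t (step o) st = st'.

Lemma reaches_refl o st : reaches o st st.
Proof. now exists 0. Qed.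

Lemma reaches_trans o st1 st2 st3 :
  reaches o st1 st2 -> reaches o st2 st3 -> reaches o st1 st3.
Proof. intros [t <-] [u <-]; exists (u + t); apply Nat.iter_add. Qed.

Lemma reaches_step o st1 st2 st3 :
  step o st1 = st2 -> reaches o st2 st3 -> reaches o st1 st3.
Proof. intros E; apply reaches_trans; now exists 1. Qed.

Ltac machine_step :=
  eapply reaches_step;
  [ unfold step; cbv zeta; cbn [encode]; unpair; cbn [Nat.eqb pred]; reflexivity | ].

(** The rest [k] of the stack is arbitrary, so that the induction hypotheses apply to subprograms
    run on top of pending frames. *)
Lemma eval_reaches o c x y :
  eval o c x y -> forall k, reaches o (pair (pair (encode c) k) x) (pair k y).
Proof.
  induction 1; intros k; machine_step; try apply reaches_refl.
  - eapply reaches_trans; [apply IHeval1|]; machine_step.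
    eapply reaches_trans; [apply IHeval2|]; machine_step; apply reaches_refl.
  - eapply reaches_trans; [apply IHeval1|apply IHeval2].
  - apply IHeval.
  - eapply reaches_trans; [apply IHeval1|]; machine_step; apply IHeval2.
  - eapply reaches_trans; [apply IHeval|]; machine_step; apply reaches_refl.
  - eapply reaches_trans; [apply IHeval1|]; machine_step; apply IHeval2.
Qed.

Definition halt_stack : nat := pair (pair 13 0) 0.

Definition start (e x : nat) : nat := pair (pair e halt_stack) x.

(* [0] while the machine is running, [S v] once it has halted with value [v]. *)
Definition output (st : nat) : nat :=
  if pfst (pfst (pfst st)) =? 13 then S (psnd st) else 0.

Lemma step_output o st : output st <> 0 -> step o st = st.
Proof.
  unfold output; destruct (Nat.eqb_spec (pfst (pfst (pfst st))) 13) as [E|];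
    [|congruence].
  intros _; unfold step; cbv zeta; now rewrite E.
Qed.

Lemma output_stable o st t u : t <= u ->
  output (Nat.iter t (step o) st) <> 0 ->
  output (Nat.iter u (step o) st) = output (Nat.iter t (step o) st).
Proof.
  intros Htu Ht; induction Htu as [|u Htu IH]; trivial.
  simpl; rewrite step_output; congruence.
Qed.

Lemma output_unique o st t u :
  output (Nat.iter t (step o) st) <> 0 -> output (Nat.iter u (step o) st) <> 0 ->
  output (Nat.iter t (step o) st) = output (Nat.iter u (step o) st).
Proof.
  intros Ht Hu; destruct (Nat.le_ge_cases t u); [symmetry|]; now apply output_stable.
Qed.

Lemma eval_output o c x y : eval o c x y ->
  exists t, output (Nat.iter t (step o) (start (encode c) x)) = S y.
Proof.
  intros H; destruct (eval_reaches _ _ _ _ H halt_stack) as [t Ht].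
  exists t; unfold start; rewrite Ht.
  unfold output, halt_stack; now unpair.
Qed.

(** The machine is deterministic, and both values are read off halted states of the same run. *)
Lemma eval_functional o c x y y' : eval o c x y -> eval o c x y' -> y = y'.
Proof.
  intros [t Ht]%eval_output [u Hu]%eval_output.
  pose proof (output_unique o (start (encode c) x) t u); lia.
Qed.

(** * Computable open sets and relations *)

(** The search [cMu f] is run on a function that ignores the searched variable and is 0 exactly when
    the test succeeds: it stops at once or runs forever. *)
Lemma ce_relation_test (B : baire -> nat -> bool) :
  computable_test B -> ce_relation (fun x y => B (fun _ => 0) (pair x y) = true).
Proof.
  intros HB.
  destruct (computable_if (fun o w => B o (pfst w)) (fun _ _ => 0) (fun _ _ => 1))
    as [f Hf]; try apply computable_const.
  { apply (computable_comp (fun o w => if B o w then 1 else 0) (fun _ w => pfst w) HB).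
    computability. }
  destruct (computable_pair (fun _ x => x) (fun _ _ => 0)) as [g Hg];
    try apply computable_id; try apply computable_const.
  exists (cComp (cMu f) g); intros x y.
  set (o := fun _ => 0) in *; set (z := pair x y); split.
  - intros E; exists 0; apply ev_comp with (pair z 0); [apply Hg|].
    apply ev_mu_stop.
    generalize (Hf o (pair z 0)); cbn beta; unpair; now rewrite E.
  - intros [v Hv]; inversion_clear Hv.
    rewrite (eval_functional _ _ _ _ _ H (Hg o z)) in H0; clear H.
    destruct (B o z) eqn:E; trivial; exfalso.
    (* If the test fails, the search cannot halt. The induction on its evaluation keeps only the
       first component [z] of the input fixed, because the counter moves. *)
    remember (cMu f) as c eqn:Ec; remember (pair z 0) as w eqn:Ew.
    assert (Hw : pfst w = z) by (subst; now unpair).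
    clear Ew; induction H0; try discriminate; injection Ec as ->.
    + pose proof (eval_functional _ _ _ _ _ H0 (Hf o _)) as C; cbn beta in C.
      rewrite Hw, E in C; discriminate.
    + apply IHeval2; trivial; revert Hw; now unpair.
Qed.

Lemma computable_of_fun (X Y : represented_space) (f : X -> Y) F :
  computable_fun F -> (forall x p, delta X p x -> delta Y (F p) (f x)) -> computable f.
Proof.
  intros [c Hc] HF.
  assert (Hfun : forall p q q' : baire, q = F p -> q' = F p -> q = q') by congruence.
  exists (PMap Hfun); split.
  - intros x p Hp; exists (F p); split; [reflexivity|now apply HF].
  - exists c; intros p q -> n; apply Hc.
Qed.

(** The sequence of test values is itself a name of the truth value in Sierpinski space. *)
Lemma computably_open_test (X : represented_space) (U : X -> Prop) B :
  computable_test B ->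
  (forall x p, delta X p x -> (U x <-> exists n, B p n = true)) ->
  computably_open U.
Proof.
  intros HB HU.
  exists (fun x => if excluded_middle_informative (U x) then Top else Bot); split.
  { intros x; destruct (excluded_middle_informative (U x)); split; congruence. }
  apply (computable_of_fun _ sierpinski_space _ _ HB).
  intros x p Hp; apply HU in Hp; simpl.
  destruct (excluded_middle_informative (U x)) as [Hx|Hx].
  - intros H0; apply Hp in Hx as [n Hn]; specialize (H0 n).
    rewrite Hn in H0; discriminate.
  - intros n; destruct (B p n) eqn:E; trivial.
    exfalso; apply Hx, Hp; now exists n.
Qed.

(** Names of ideals enumerate their elements, so a search over two positions and a bound [s], all
    coded in one number, finds every witness. Even and odd places hold the two components of the
    name. *)
Lemma computably_open_ideal_pair R (U : prod_space (ideal_space R) (ideal_space R) -> Prop)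
    (B : nat -> nat -> nat -> bool) :
  computable_test (fun _ w => B (pfst w) (pfst (psnd w)) (psnd (psnd w))) ->
  (forall I J : ideal_space R, U (I, J) <->
     exists x y s, proj1_sig I x /\ proj1_sig J y /\ B x y s = true) ->
  computably_open U.
Proof.
  intros HB HU.
  apply (computably_open_test _ U (fun p n =>
    B (p (2 * pfst n)) (p (2 * pfst (psnd n) + 1)) (psnd (psnd n)))).
  - apply (computable_fun_ext (fun p n => (fun (_ : baire) w =>
      if B (pfst w) (pfst (psnd w)) (psnd (psnd w)) then 1 else 0) p
      (pair (p (2 * pfst n)) (pair (p (2 * pfst (psnd n) + 1)) (psnd (psnd n)))))).
    { intros o x; now unpair. }
    apply (computable_comp _ (fun p n =>
      pair (p (2 * pfst n)) (pair (p (2 * pfst (psnd n) + 1)) (psnd (psnd n)))) HB).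
    simpl; computability.
  - intros [I J] p [HI HJ]; simpl in HI, HJ; rewrite HU; split.
    + intros (x & y & s & Hx & Hy & H).
      apply HI in Hx as [k <-]; apply HJ in Hy as [l <-].
      exists (pair k (pair l s)); now unpair.
    + intros [n Hn]; do 3 eexists; repeat split; [| |exact Hn].
      * apply HI; now eexists.
      * apply HJ; now eexists.
Qed.

(** * The diagonal relation *)

(* [pair e m] lies in the component of the program coded by [e], at level [m];
   levels serve both as the order along a chain and as running times. *)
Definition colour (x : nat) : bool := pfst (psnd x) =? 0.

(** Runs through exactly the elements of colour [b] in component [e], so this sequence doubles as a
    name of that colour class whenever the class is an ideal. Tag 0 is colour [true]; all other tags
    are colour [false]. *)
Definition chain (e : nat) (b : bool) : baire := fun s =>
  pair e (if b then pair 0 s else pair (S (pfst s)) (psnd s)).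

(** Input 0 suffices, since a name of a natural number is read at position 0. *)
Definition result (e : nat) (b : bool) (s : nat) : nat :=
  output (Nat.iter s (step (chain e b)) (start e 0)).

Definition halted (e : nat) (b : bool) (s : nat) : bool := negb (result e b s =? 0).

Definition both_halted (e s : nat) : bool := halted e true s && halted e false s.

Definition agree (e s : nat) : bool :=
  both_halted e s && (result e true s =? result e false s).

Definition differ (e s : nat) : bool :=
  both_halted e s && negb (result e true s =? result e false s).

Definition live (e : nat) (b : bool) (s : nat) : bool :=
  if b then halted e false s else negb (halted e false s) || halted e true s.

(** Liveness is asked of the upper element only: an element at a level that is not live has no
    predecessors unless the outputs differ, so no ideal can use it as an upper bound. Once [differ]
    holds, colours are ignored and the chains merge. *)
Definition below (x y : nat) : bool :=
  (pfst x =? pfst y) && (psnd x <? psnd y) &&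
  (differ (pfst y) (psnd y) ||
   eqb (colour x) (colour y) && live (pfst y) (colour y) (psnd y)).

Definition diag_rel : relation nat := fun x y => below x y = true.

(** [chain e b] is computable from [e], so the answers to the oracle queries of the simulated
    program can be computed along the way. *)
Lemma computable_result b E T : computable_fun E -> computable_fun T ->
  computable_fun (fun o x => result (E o x) b (T o x)).
Proof.
  intros HE HT; unfold result.
  set (F := fun w => output (Nat.iter (psnd w) (step (chain (pfst w) b)) (start (pfst w) 0))).
  apply (computable_fun_ext (fun o x => F (pair (E o x) (T o x)))).
  { intros o x; unfold F; now unpair. }
  apply (computable_comp (fun _ => F) (fun o x => pair (E o x) (T o x)));
    [|now apply computable_pair].
  assert (H : computable_fun (fun _ w =>
    Nat.iter (psnd w) (step (chain (pfst w) b)) (start (pfst w) 0))).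
  { apply (computable_iter (fun _ w => psnd w) (fun _ w => start (pfst w) 0)
      (fun _ w => step (chain (pfst w) b))); [computability|unfold start; computability|].
    apply (computable_step (fun _ w => chain (pfst (pfst w)) b)); unfold chain;
      destruct b; computability. }
  unfold F, output; computability.
Qed.

Lemma computable_halted b E T : computable_fun E -> computable_fun T ->
  computable_test (fun o x => halted (E o x) b (T o x)).
Proof. intros HE HT; pose proof (computable_result b E T HE HT); unfold halted; computability. Qed.

Ltac computability_hook ::= first [ apply computable_halted | apply computable_result ].

Lemma colour_chain e b s : colour (chain e b s) = b.
Proof. unfold colour, chain; destruct b; now unpair. Qed.

Lemma pfst_chain e b s : pfst (chain e b s) = e.
Proof. unfold chain; now unpair. Qed.

Lemma chain_surjective x : exists s, chain (pfst x) (colour x) s = x.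
Proof.
  pose proof (pair_eta x) as E; pose proof (pair_eta (psnd x)) as E'.
  unfold chain, colour; destruct (Nat.eqb_spec (pfst (psnd x)) 0) as [H|H].
  - exists (psnd (psnd x)); congruence.
  - exists (pair (pred (pfst (psnd x))) (psnd (psnd x))); unpair.
    rewrite Nat.succ_pred by trivial; congruence.
Qed.

(** Supplies upper bounds of either colour at high levels. The levels along [chain e false] follow
    no simple order, but position [pair 0 n] works for both colours. *)
Lemma chain_unbounded e b n : n <= psnd (chain e b (pair 0 n)).
Proof.
  unfold chain; unpair; destruct b; [|apply le_pair_r].
  transitivity (pair 0 n); apply le_pair_r.
Qed.

(** * Persistence of halting, agreement and difference *)

Lemma result_stable e b s t : s <= t -> halted e b s = true -> result e b t = result e b s.
Proof.
  unfold halted; rewrite negb_true_iff, Nat.eqb_neq; apply output_stable.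
Qed.

Lemma halted_mono e b s t : s <= t -> halted e b s = true -> halted e b t = true.
Proof. intros Hst H; unfold halted; now rewrite (result_stable e b s t). Qed.

Lemma differ_mono e s t : s <= t -> differ e s = true -> differ e t = true.
Proof.
  unfold differ, both_halted; rewrite !andb_true_iff; intros Hst [[H1 H2] H].
  rewrite !(result_stable _ _ _ _ Hst) by trivial.
  now repeat split; try apply (halted_mono _ _ _ _ Hst).
Qed.

Lemma agree_mono e s t : s <= t -> agree e s = true -> agree e t = true.
Proof.
  unfold agree, both_halted; rewrite !andb_true_iff; intros Hst [[H1 H2] H].
  rewrite !(result_stable _ _ _ _ Hst) by trivial.
  now repeat split; try apply (halted_mono _ _ _ _ Hst).
Qed.

Lemma agree_not_differ e s t : agree e s = true -> differ e t = true -> False.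
Proof.
  intros H1%(agree_mono _ _ (s + t)) H2%(differ_mono _ _ (s + t)); try lia.
  unfold agree, differ in *; destruct (result _ _ _ =? result _ _ _);
    rewrite ?andb_false_r in *; discriminate.
Qed.

Lemma agree_or_differ e s :
  halted e true s = true -> halted e false s = true ->
  agree e s = true \/ differ e s = true.
Proof.
  intros H1 H2; unfold agree, differ, both_halted; rewrite H1, H2; simpl.
  destruct (_ =? _); auto.
Qed.

Lemma diag_relE x y : diag_rel x y <->
  pfst x = pfst y /\ psnd x < psnd y /\
  (differ (pfst y) (psnd y) = true \/
   colour x = colour y /\ live (pfst y) (colour y) (psnd y) = true).
Proof.
  unfold diag_rel, below.
  now rewrite !andb_true_iff, orb_true_iff, andb_true_iff, Nat.eqb_eq, Nat.ltb_lt,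
    eqb_true_iff, and_assoc.
Qed.

(** The condition at the top element is inherited. Only a first step across colours followed by a
    step within a colour needs care: there [differ] persists to the higher level. *)
Lemma diag_rel_trans : transitive nat diag_rel.
Proof.
  intros x y z; rewrite !diag_relE; intros (E1 & L1 & H1) (E2 & L2 & H2).
  rewrite E1, E2 in *; repeat split; try lia.
  destruct H2 as [H2|[E H2]]; [now left|].
  destruct H1 as [H1|[E' H1]].
  - left; apply (differ_mono _ (psnd y)); trivial; lia.
  - right; split; congruence.
Qed.

Lemma diag_rel_ce : ce_relation diag_rel.
Proof.
  destruct (ce_relation_test (fun _ w => below (pfst w) (psnd w))) as [c Hc].
  - unfold below, agree, differ, live, both_halted, colour; computability.
  - exists c; intros x y; rewrite <- Hc; now unpair.
Qed.

(** * Structure of the ideals *)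

Section Ideals.

Variable I : nat -> Prop.
Hypothesis HI : is_ideal diag_rel I.

Lemma ideal_directed x y : I x -> I y -> exists z, I z /\ diag_rel x z /\ diag_rel y z.
Proof. apply HI. Qed.

Lemma ideal_lower x y : diag_rel x y -> I y -> I x.
Proof. apply HI. Qed.

Lemma ideal_component x y : I x -> I y -> pfst x = pfst y.
Proof.
  intros Hx Hy; destruct (ideal_directed x y Hx Hy) as (z & _ & H1 & H2).
  rewrite diag_relE in H1, H2; intuition congruence.
Qed.

(** Directedness applied to an element and itself yields an element of strictly larger level. *)
Lemma ideal_unbounded x n : I x -> exists z, I z /\ diag_rel x z /\ n < psnd z.
Proof.
  intros Hx; induction n as [|n (z & Hz & H & L)].
  - destruct (ideal_directed x x Hx Hx) as (z & Hz & H & _).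
    exists z; repeat split; trivial; rewrite diag_relE in H; lia.
  - destruct (ideal_directed z z Hz Hz) as (z' & Hz' & H' & _).
    exists z'; repeat split; trivial.
    + now apply diag_rel_trans with z.
    + rewrite diag_relE in H'; lia.
Qed.

(** A common upper bound shares its colour with at most one of the two, so the other one lies below
    it because of [differ]. *)
Lemma ideal_two_colours x y :
  I x -> I y -> colour x <> colour y -> exists s, differ (pfst x) s = true.
Proof.
  intros Hx Hy N; destruct (ideal_directed x y Hx Hy) as (z & _ & H1 & H2).
  rewrite diag_relE in H1, H2; destruct H1 as (-> & _ & H1), H2 as (_ & _ & H2).
  exists (psnd z); destruct H1 as [|[]], H2 as [|[]]; congruence.
Qed.

End Ideals.

(** Above [y] the ideal has elements of arbitrarily high level. Beyond level [psnd x + s] such an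
    element is also above [x]: by the same colour and liveness, or because [differ] has set in. *)
Lemma ideal_contains I x y s : is_ideal diag_rel I ->
  I y -> pfst x = pfst y -> colour x = colour y \/ differ (pfst x) s = true -> I x.
Proof.
  intros HI Hy E H.
  destruct (ideal_unbounded I HI y (psnd x + s) Hy) as (z & Hz & Hyz & L).
  apply (ideal_lower I HI x z); trivial.
  rewrite diag_relE in *; destruct Hyz as (E' & _ & H'); repeat split; try congruence; try lia.
  destruct H' as [H'|[E'' H']]; [now left|].
  destruct H as [H|H].
  - right; split; congruence.
  - left; apply (differ_mono _ s); [lia|congruence].
Qed.

(** An element coloured like [x] passes to [J] by the criterion for [x] and [y]; one of the other
    colour shows that [I] has both colours, hence that the outputs differ. *)
Lemma ideal_inclusion I J x y s : is_ideal diag_rel I -> is_ideal diag_rel J ->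
  I x -> J y -> pfst x = pfst y -> colour x = colour y \/ differ (pfst x) s = true ->
  forall a, I a -> J a.
Proof.
  intros HI HJ Hx Hy E H a Ha.
  pose proof (ideal_component I HI a x Ha Hx) as Ea.
  destruct (Bool.bool_dec (colour a) (colour x)) as [C|C].
  - apply (ideal_contains J a y s); trivial; [congruence|].
    destruct H; [left|right]; congruence.
  - destruct (ideal_two_colours I HI a x Ha Hx C) as [t Ht].
    apply (ideal_contains J a y t); auto; congruence.
Qed.

Lemma ideal_eq (I J : ideal_space diag_rel) x y s :
  proj1_sig I x -> proj1_sig J y -> pfst x = pfst y ->
  colour x = colour y \/ differ (pfst x) s = true -> I = J.
Proof.
  destruct I as [I HI], J as [J HJ]; simpl; intros Hx Hy E H.
  assert (EIJ : I = J).
  { extensionality a; apply propositional_extensionality; split.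
    - now apply (ideal_inclusion I J x y s).
    - apply (ideal_inclusion J I y x s); trivial; [congruence|].
      destruct H; [left|right]; congruence. }
  subst J; f_equal; apply proof_irrelevance.
Qed.

Lemma ideal_live I x : is_ideal diag_rel I -> I x ->
  (forall s, differ (pfst x) s = false) ->
  forall n, exists s, n <= s /\ live (pfst x) (colour x) s = true.
Proof.
  intros HI Hx N n.
  destruct (ideal_unbounded I HI x n Hx) as (z & _ & H & L).
  rewrite diag_relE in H; destruct H as (E & _ & [H|[C H]]).
  - rewrite <- E, N in H; discriminate.
  - exists (psnd z); rewrite E, C; split; trivial; lia.
Qed.

(** Without [differ], both chains have live levels arbitrarily high. Liveness of [true] shows that
    the program halted on [false]; liveness of [false] at a later level then forces a halt on
    [true]. *)
Lemma ideals_of_both_colours I J x y : is_ideal diag_rel I -> is_ideal diag_rel J ->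
  I x -> J y -> pfst x = pfst y -> colour x <> colour y ->
  exists s, agree (pfst x) s = true \/ differ (pfst x) s = true.
Proof.
  revert I J x y.
  assert (W : forall I J x y, is_ideal diag_rel I -> is_ideal diag_rel J ->
    I x -> J y -> pfst x = pfst y -> colour x = true -> colour y = false ->
    exists s, agree (pfst x) s = true \/ differ (pfst x) s = true).
  { intros I J x y HI HJ Hx Hy E Cx Cy.
    destruct (classic (exists s, differ (pfst x) s = true)) as [[s Hs]|N];
      [exists s; now right|].
    assert (N' : forall s, differ (pfst x) s = false).
    { intros s; apply not_true_is_false; intros H; apply N; now exists s. }
    destruct (ideal_live I x HI Hx N' 0) as (s & _ & Hs).
    rewrite E in N'; destruct (ideal_live J y HJ Hy N' s) as (t & Hst & Ht).
    rewrite Cx in Hs; rewrite Cy in Ht; rewrite <- E in Ht; simpl in Hs, Ht.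
    apply (halted_mono _ _ _ _ Hst) in Hs; rewrite Hs in Ht; simpl in Ht.
    exists t; now apply agree_or_differ. }
  intros I J x y HI HJ Hx Hy E C.
  destruct (colour x) eqn:Cx, (colour y) eqn:Cy; try congruence.
  - now apply (W I J x y).
  - rewrite E; now apply (W J I y x).
Qed.

(** * Deciding equality of points from their elements *)

Lemma diag_discrete : computably_discrete (ideal_space diag_rel).
Proof.
  apply (computably_open_ideal_pair _ _ (fun x y s =>
    (pfst x =? pfst y) && (eqb (colour x) (colour y) || differ (pfst x) s))).
  - unfold agree, differ, both_halted, colour; computability.
  - intros I J; unfold diagonal; simpl; split.
    + intros <-; destruct (proj2_sig I) as [[x Hx] _].
      exists x, x, 0; repeat split; trivial; now rewrite Nat.eqb_refl, eqb_reflx.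
    + intros (x & y & s & Hx & Hy & H).
      rewrite andb_true_iff, orb_true_iff, Nat.eqb_eq, eqb_true_iff in H.
      now apply (ideal_eq I J x y s).
Qed.

(** Distinct points of one component have different colours, and then [agree] must occur, since
    [differ] would merge them. Conversely [agree] excludes [differ], so a single ideal cannot
    contain both colours. *)
Lemma diag_hausdorff : computably_hausdorff (ideal_space diag_rel).
Proof.
  apply (computably_open_ideal_pair _ _ (fun x y s =>
    negb (pfst x =? pfst y) || negb (eqb (colour x) (colour y)) && agree (pfst x) s)).
  - unfold agree, differ, both_halted, colour; computability.
  - intros I J; unfold diagonal; simpl; split.
    + intros N; destruct (proj2_sig I) as [[x Hx] _], (proj2_sig J) as [[y Hy] _].
      destruct (Nat.eqb_spec (pfst x) (pfst y)) as [E|E].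
      * destruct (Bool.bool_dec (colour x) (colour y)) as [C|C].
        { exfalso; apply N; apply (ideal_eq I J x y 0); auto. }
        destruct (ideals_of_both_colours _ _ x y (proj2_sig I) (proj2_sig J) Hx Hy E C)
          as [s [H|H]].
        -- exists x, y, s; repeat split; trivial.
           rewrite H, (proj2 (eqb_false_iff _ _) C); apply orb_true_r.
        -- exfalso; apply N; apply (ideal_eq I J x y s); auto.
      * exists x, y, 0; repeat split; trivial.
        now rewrite (proj2 (Nat.eqb_neq _ _) E).
    + intros (x & y & s & Hx & Hy & H) <-.
      pose proof (ideal_component _ (proj2_sig I) x y Hx Hy) as E.
      rewrite (proj2 (Nat.eqb_eq _ _) E) in H; simpl in H.
      apply andb_true_iff in H as [C H]; rewrite negb_true_iff, eqb_false_iff in C.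
      destruct (ideal_two_colours _ (proj2_sig I) x y Hx Hy C) as [t Ht].
      exact (agree_not_differ _ _ _ H Ht).
Qed.

Lemma ideal_space_quasi_Polish R :
  transitive nat R -> ce_relation R -> precomputably_quasi_Polish (ideal_space R).
Proof.
  intros HT HR; exists R; repeat split; trivial.
  assert (H : @computable (ideal_space R) (ideal_space R) (fun x => x)).
  { apply (computable_of_fun _ _ _ (fun o n => o n)); trivial; computability. }
  now exists (fun x => x), (fun x => x).
Qed.

(** * Diagonalisation *)

Definition colour_class (e : nat) (b : bool) : nat -> Prop :=
  fun x => pfst x = e /\ colour x = b.

Lemma colour_class_ideal e b s0 :
  (forall s, differ e s = false) -> (forall s, s0 <= s -> live e b s = true) ->
  is_ideal diag_rel (colour_class e b).
Proof.
  intros N L; repeat split.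
  - exists (chain e b 0); split; [apply pfst_chain|apply colour_chain].
  - destruct H0 as [E _]; rewrite diag_relE in H; intuition congruence.
  - destruct H0 as [E C]; rewrite diag_relE in H; destruct H as (_ & _ & [H|[]]);
      [rewrite E, N in H; discriminate|congruence].
  - intros x y [Ex Cx] [Ey Cy].
    (* The level of [z] exceeds those of [x] and [y] and the bound [s0] from which the chain is
       live. *)
    set (z := chain e b (pair 0 (S (s0 + psnd x + psnd y)))).
    pose proof (chain_unbounded e b (S (s0 + psnd x + psnd y))) as B; fold z in B.
    assert (Ez : pfst z = e) by apply pfst_chain.
    assert (Cz : colour z = b) by apply colour_chain.
    exists z; rewrite !diag_relE, Ez, Cz; repeat split; trivial; try lia;
      right; split; trivial; apply L; lia.
Qed.

Lemma component_ideal e s0 : differ e s0 = true -> is_ideal diag_rel (fun x => pfst x = e).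
Proof.
  intros D; repeat split.
  - exists (chain e true 0); apply pfst_chain.
  - intros x y H E; rewrite diag_relE in H; intuition congruence.
  - intros x y Ex Ey.
    set (z := chain e true (pair 0 (S (s0 + psnd x + psnd y)))).
    pose proof (chain_unbounded e true (S (s0 + psnd x + psnd y))) as B; fold z in B.
    assert (Ez : pfst z = e) by apply pfst_chain.
    exists z; rewrite !diag_relE, Ez; repeat split; trivial; try lia;
      left; apply (differ_mono _ s0); trivial; lia.
Qed.

Lemma chain_names_colour_class e b (H : is_ideal diag_rel (colour_class e b)) :
  delta (ideal_space diag_rel) (chain e b) (exist _ _ H).
Proof.
  intros x; simpl; split.
  - intros [<- <-]; apply chain_surjective.
  - intros [s <-]; split; [apply pfst_chain|apply colour_chain].
Qed.

Lemma not_computably_injective :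
  ~ exists iota : ideal_space diag_rel -> nat_space, computable iota /\ Injective iota.
Proof.
  intros (iota & (F & HF & c & Hc) & Hinj).
  set (e := encode c).
  assert (run : forall I p, delta (ideal_space diag_rel) p I ->
    exists s, output (Nat.iter s (step p) (start e 0)) = S (iota I)).
  { intros I p Hp; destruct (HF I p Hp) as (q & Hq & Eq); simpl in Eq.
    apply eval_output; rewrite <- Eq; now apply Hc. }
  assert (name : forall b (H : is_ideal diag_rel (colour_class e b)),
    exists s, result e b s = S (iota (exist _ _ H))).
  { intros b H; apply (run (exist _ _ H)), chain_names_colour_class. }
  assert (name_halted : forall b, is_ideal diag_rel (colour_class e b) ->
    exists s, halted e b s = true).
  { intros b H; destruct (name b H) as [s Hs]; exists s.
    unfold halted; now rewrite Hs. }
  (* Without a halt on the [false] chain, that chain would be live at every level and hence a point,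
     on whose name [e] has to halt. *)
  assert (halted_false : exists s, halted e false s = true).
  { apply NNPP; intros N.
    assert (N' : forall s, halted e false s = false).
    { intros s; apply not_true_is_false; intros H; apply N; now exists s. }
    apply N, name_halted, (colour_class_ideal e false 0).
    - intros s; unfold differ, both_halted; now rewrite N', andb_false_r.
    - intros s _; simpl; now rewrite N'. }
  destruct halted_false as [s Hs].
  (* From level [s] on the [true] chain is live, and without a halt on it [differ] never holds; so
     it would be a point, on whose name [e] has to halt. *)
  assert (halted_true : exists t, halted e true t = true).
  { apply NNPP; intros N.
    assert (N' : forall t, halted e true t = false).
    { intros t; apply not_true_is_false; intros H; apply N; now exists t. }
    apply N, name_halted, (colour_class_ideal e true s).
    - intros t; unfold differ, both_halted; now rewrite N'.
    - intros t Hst; now apply (halted_mono _ _ s). }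
  destruct halted_true as [t Ht].
  apply (halted_mono _ _ s (s + t)) in Hs; [|lia].
  apply (halted_mono _ _ t (s + t)) in Ht; [|lia].
  revert Hs Ht; generalize (s + t); clear s t; intros s Hf Ht.
  destruct (agree_or_differ e s Ht Hf) as [A|D].
  (* With agreement both chains are live from [s] on and remain distinct points, yet [iota] gives
     them the same value. *)
  - assert (H : forall b, is_ideal diag_rel (colour_class e b)).
    { intros b; apply (colour_class_ideal e b s).
      - intros u; apply not_true_is_false; intros D; exact (agree_not_differ _ _ _ A D).
      - intros u Hu; apply (halted_mono _ _ _ _ Hu) in Hf, Ht.
        unfold live; rewrite Hf, Ht; now destruct b. }
    assert (value : forall b, result e b s = S (iota (exist _ _ (H b)))).
    { intros b; destruct (name b (H b)) as [u Hu]; rewrite <- Hu.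
      assert (Hb : halted e b s = true) by now destruct b.
      unfold halted in Hb; rewrite negb_true_iff, Nat.eqb_neq in Hb.
      apply output_unique; trivial; unfold result in Hu; congruence. }
    unfold agree in A; rewrite andb_true_iff, Nat.eqb_eq, !value in A.
    destruct A as [_ A]; injection A as A; apply Hinj in A.
    apply (f_equal (fun I : ideal_space diag_rel => proj1_sig I (chain e true 0))) in A.
    simpl in A.
    assert (B : colour_class e true (chain e true 0))
      by (split; [apply pfst_chain|apply colour_chain]).
    rewrite A in B; destruct B as [_ B]; rewrite colour_chain in B; discriminate.
  (* With different outputs the whole component is the single point [I]; both runs must then return
     [iota I], contradicting [differ]. *)
  - pose (I := exist _ _ (component_ideal e s D) : ideal_space diag_rel).
    (* The run on [chain e b] only sees a finite part of the oracle, which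
       extends to a name of the merged ideal. *)
    assert (value : forall b, result e b s = S (iota I)).
    { intros b.
      destruct (iter_step_local (chain e b) s (start e 0)) as [n Hn].
      set (p := fun k => if k <? n then chain e b k else pair e (k - n)).
      assert (Hp : delta (ideal_space diag_rel) p I).
      { intros x; simpl; split.
        - intros <-; exists (psnd x + n); unfold p.
          destruct (Nat.ltb_spec (psnd x + n) n); [lia|].
          rewrite Nat.add_sub; apply pair_eta.
        - intros [k <-]; unfold p; destruct (k <? n); [apply pfst_chain|].
          apply pfst_pair. }
      destruct (run I p Hp) as [u Hu]; rewrite <- Hu.
      assert (Hb : halted e b s = true) by now destruct b.
      unfold halted, result in Hb |- *; rewrite negb_true_iff, Nat.eqb_neq in Hb.
      rewrite <- (Hn p) in Hb |- *.
      - apply output_unique; congruence.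
      - intros k Hk; unfold p; now rewrite (proj2 (Nat.ltb_lt _ _) Hk).
      - intros k Hk; unfold p; now rewrite (proj2 (Nat.ltb_lt _ _) Hk). }
    pose proof D as D'.
    unfold differ in D'; rewrite !value, Nat.eqb_refl, andb_false_r in D'; discriminate.
Qed.

Theorem mainTheorem4 :
  exists X : represented_space,
    computably_discrete X /\
    computably_hausdorff X /\
    precomputably_quasi_Polish X /\
    ~ (exists iota : X -> nat_space, computable iota /\ Injective iota).
Proof.
  exists (ideal_space diag_rel).
  exact (conj diag_discrete (conj diag_hausdorff
    (conj (ideal_space_quasi_Polish _ diag_rel_trans diag_rel_ce)
      not_computably_injective))).
Qed.
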